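(* Let $E(0,\infty)=L_1(0,\infty)$ and let $$F(0,\infty)=\{x\in(L_{1,\infty}+L_\infty)(0,\infty):\ \exists\, y\in E(0,\infty),\ \mu(x)\le S\mu(y)\}.$$ Then $F(0,\infty)=(L_{1,\infty}(0,\infty))^0$, where $(L_{1,\infty}(0,\infty))^0=\{x\in L_{1,\infty}(0,\infty):\lim_{t\to0+}t\mu(t,x)=0\}$.
   Context: For a measurable function $x$ on $(0,\infty)$ with $m(\{|x|>s\})<\infty$ for some $s>0$ ($m$ Lebesgue measure), $\mu(t,x)=\inf\{s\ge0:m(\{|x|>s\})\le t\}$, $t>0$, is the decreasing rearrangement. $L_{1,\infty}(0,\infty)$ consists of such $x$ with $\sup_{t>0}t\mu(t,x)<\infty$. The Calderón operator is $(Sx)(t)=\frac1t\int_0^tx(s)\,ds+\int_t^\infty x(s)\frac{ds}s$, defined for $x$ with $\int_0^\infty\mu(s,x)\frac{ds}{1+s}<\infty$. *)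

(* Defs.v *)
From HB Require Import structures.
From mathcomp Require Import all_boot all_order all_algebra.
From mathcomp Require Import all_classical all_reals all_analysis.

Set Implicit Arguments.
Unset Strict Implicit.
Unset Printing Implicit Defensive.

Import Order.TTheory GRing.Theory Num.Theory.
Import numFieldNormedType.Exports.

Local Open Scope classical_set_scope.
Local Open Scope ring_scope.
Local Open Scope ereal_scope.

(* A function on (0, oo) is represented by x : R -> R; its values outside
   (0, oo) never matter, so membership in each of the function sets below only
   depends on the restriction of x to (0, oo).  All the conditions are moreover
   invariant under modification on a null set, hence an equality between these
   sets of functions is an equality between the corresponding spaces of
   almost-everywhere classes. *)

(* R with the sigma-algebra of Lebesgue measurable sets (the library's default
   structure on R is the Borel one); it is convertible to R. *)
Notation lebesgueR R := (caratheodory_type (@wlength R idfun)^*%mu).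

Notation lebesgue := completed_lebesgue_measure.

Definition Lebesgue_measurable_fun (R : realType) (x : R -> R) : Prop :=
  measurable_fun (`]0%R, +oo[ : set (lebesgueR R)) (x : lebesgueR R -> R).

Definition distribution_fun (R : realType) (x : R -> R) (s : R) : \bar R :=
  lebesgue [set t : R | (0 < t)%R /\ (s < `|x t|)%R].

(* The functions for which the decreasing rearrangement is considered. *)
Definition rearrangeable (R : realType) : set (R -> R) :=
  [set x | Lebesgue_measurable_fun x /\
           exists s : R, (0 < s)%R /\ distribution_fun x s < +oo].

Definition rearrangement (R : realType) (x : R -> R) (t : R) : \bar R :=
  ereal_inf [set s%:E | s in [set s : R | (0 <= s)%R /\
                                          distribution_fun x s <= t%:E]].

Definition L1 (R : realType) : set (R -> R) :=
  [set x | (@lebesgue R).-integrable `]0%R, +oo[ (fun t => (x t)%:E)].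

Definition Linfty (R : realType) : set (R -> R) :=
  [set x | Lebesgue_measurable_fun x /\
           exists M : R, {ae @lebesgue R, forall t : lebesgueR R,
             (0 < (t : R))%R -> (`|x t| <= M)%R}].

Definition weakL1 (R : realType) : set (R -> R) :=
  [set x | rearrangeable x /\
           ereal_sup [set t%:E * rearrangement x t | t in `]0%R, +oo[] < +oo].

Definition weakL1_plus_Linfty (R : realType) : set (R -> R) :=
  [set (fun t => u t + v t)%R | u in @weakL1 R & v in @Linfty R].

Definition weakL1_0 (R : realType) : set (R -> R) :=
  [set x | weakL1 x /\ t%:E * rearrangement x t @[t --> 0%R^'+] --> 0].

Definition calderon (R : realType) (f : R -> \bar R) (t : R) : \bar R :=
  t^-1%:E * (\int[@lebesgue R]_(s in `]0%R, t]) f s) +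
  \int[@lebesgue R]_(s in `]t, +oo[) (f s * (s : R)^-1%:E).

(* For E contained in the domain of the Calderon operator (as L1 is), the
   integrals in [calderon (rearrangement y)] are those of nonnegative functions
   and are finite. *)
Definition calderon_range (R : realType) (E : set (R -> R)) : set (R -> R) :=
  [set x | weakL1_plus_Linfty x /\
           exists y, E y /\
             forall t : R, (0 < t)%R ->
               rearrangement x t <= calderon (rearrangement y) t].

(* Main.v *)
Require Import Defs.
From HB Require Import structures.
From mathcomp Require Import all_boot all_order all_algebra.
From mathcomp Require Import all_classical all_reals all_analysis.
From mathcomp Require Import measurable_realfun.

Set Implicit Arguments.
Unset Strict Implicit.
Unset Printing Implicit Defensive.

Import Order.TTheory GRing.Theory Num.Theory.
Import numFieldNormedType.Exports.

Local Open Scope classical_set_scope.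
Local Open Scope ring_scope.
Local Open Scope ereal_scope.

(** Write P for (0, oo).

    Every x in the Calderon range of L_1 lies in (L_(1,oo))^0.  For a
    nonnegative nonincreasing g,
      t * (S g)(t) = \int_P g(s) min(1, t / s) ds.
    When g is integrable this quantity is bounded by the integral of g, and it
    tends to 0 with t by dominated convergence ([calderon_kernel],
    [calderon_le_integral], [calderon_cvg0]).  This applies to g = mu(y) for y
    in L_1, because \int_P mu(y) <= \int_P |y| ([integral_rearrangement_le],
    by comparing the layer-cake formulas of both sides).  Hence
    mu(x) <= S mu(y) makes t mu(t, x) bounded and infinitesimal at 0+.

    Conversely, let t mu(t, x) be bounded and infinitesimal at 0+.  Fix C with
    t mu(t, x) <= C / 2 for all t, and choose tau_k -> 0 such that
    t mu(t, x) <= C / 2^(k+2) for t < tau_k.  The function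
      y = \sum_k (C / 2^(k+1)) tau_k^-1 \1_(0, tau_k)
    has integral at most C.  Given t, let k be the least index with
    tau_k <= t.  The k-th term alone gives
      \int_0^t mu(y) >= C / 2^(k+1) >= t mu(t, x),
    the last inequality because k = 0 or t < tau_(k-1).  So the first term of
    S mu(y) already dominates mu(x). *)

(** * Lebesgue measure and monotone functions on the half-line *)

Lemma measurable_lebesgueR (R : realType) (A : set R) :
  measurable (A : set (measurableTypeR R)) ->
  measurable (A : set (lebesgueR R)).
Proof. exact: sub_caratheodory. Qed.

Lemma measurable_itv_lebesgueR (R : realType) (i : interval R) :
  measurable ([set` i] : set (lebesgueR R)).
Proof. by apply: measurable_lebesgueR; exact: measurable_itv. Qed.

Lemma lebesgue_itv0 (R : realType) (a : R) : (0 < a)%R ->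
  @lebesgue R `]0%R, a[ = a%:E.
Proof.
by move=> a0; rewrite [LHS]lebesgue_measure_itv/= lte_fin a0 oppr0 adde0.
Qed.

(** [lebesgue] has the values of an outer measure, which is monotone on
    arbitrary sets. *)
Lemma le_lebesgue (R : realType) (A B : set (lebesgueR R)) :
  A `<=` B -> @lebesgue R A <= @lebesgue R B.
Proof. exact: (@le_mu_ext _ _ _ (wlength idfun)). Qed.

(** The superlevel sets are intervals. *)
Lemma nonincreasing_emeasurable (R : realType) (f : R -> \bar R) :
  (forall s t : R, (0 < s)%R -> (s <= t)%R -> f t <= f s) ->
  measurable_fun (`]0%R, +oo[ : set R) f.
Proof.
move=> f_ni; apply: (measurability _ (ErealGenCInfty.measurableE R)) => //.
move=> /= _ [_] [r] -> <-.
apply: is_interval_measurable => s t/=.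
rewrite !in_itv/= !andbT => -[s0 fs] [t0 ft] u /andP[su ut].
have u0 : (0 < u)%R by rewrite (lt_le_trans s0).
by rewrite !in_itv/= !andbT; split => //; rewrite (le_trans ft)// f_ni.
Qed.

Lemma nonincreasing_measurable_lebesgueR (R : realType) (f : R -> \bar R) :
  (forall s t : R, (0 < s)%R -> (s <= t)%R -> f t <= f s) ->
  measurable_fun (`]0%R, +oo[ : set (lebesgueR R)) (f : lebesgueR R -> \bar R).
Proof.
move=> /nonincreasing_emeasurable mf _ Y mY.
by apply: measurable_lebesgueR; apply: mf => //; exact: measurable_itv.
Qed.

(** * The layer-cake formula *)

(** Stated for an extended real [a], so as to apply both to the values of a
    function in the layer-cake formula and to a possibly infinite distribution
    function. *)
Lemma lebesgue_measure_ray (R : realType) (a : \bar R) : 0 <= a ->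
  lebesgue_measure [set s : R | (0 < s)%R /\ s%:E < a] = a.
Proof.
case: a => [r||//] r0.
- have -> : [set s : R | (0 < s)%R /\ s%:E < r%:E] = `]0%R, r[%classic.
    by apply/seteqP; split => s /=; rewrite in_itv/= lte_fin => /andP.
  rewrite lebesgue_measure_itv/= lte_fin; case: ltP => [_|].
    by rewrite oppr0 adde0.
  by move=> r0'; congr EFin; apply/le_anti; rewrite r0' andbT -lee_fin.
- have -> : [set s : R | (0 < s)%R /\ s%:E < +oo] = `]0%R, +oo[%classic.
    apply/seteqP; split => s /=; rewrite in_itv/= andbT; first by case.
    by rewrite ltry.
  by rewrite lebesgue_measure_itv/= ltry.
Qed.

(** Both sides are the product measure of the region {(x, s) | 0 < s < f x},
    sliced along x or along s. *)
Lemma layer_cake d (T : measurableType d) (R : realType)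
    (m : {sigma_finite_measure set T -> \bar R}) (D : set T) (f : T -> \bar R) :
  measurable D -> measurable_fun D f -> (forall x, D x -> 0 <= f x) ->
  \int[m]_(x in D) f x =
  \int[@lebesgue_measure R]_(s in `]0%R, +oo[) m (D `&` [set x | s%:E < f x]).
Proof.
move=> mD mf f0.
pose h := f \_ D.
have h0 x : 0 <= h x by exact: erestrict_ge0.
have mh : measurable_fun setT h by exact/(measurable_restrictT _ _).1.
pose A : set (T * measurableTypeR R) := [set p | (0 < p.2)%R /\ p.2%:E < h p.1].
have mA : measurable A.
  have -> : A = (setT `*` `]0%R, +oo[) `&` [set p | p.2%:E < h p.1].
    apply/seteqP; split => p /=; rewrite in_itv/= andbT; first by move=> [].
    by move=> [[]].
  apply: measurable_lte.
  - exact: measurableX.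
  - by apply/measurable_EFinP; apply: measurable_funTS; exact: measurable_snd.
  - apply: measurable_funTS; apply: (measurableT_comp mh).
    exact: measurable_fst.
rewrite integral_mkcond -/h.
transitivity (\int[m]_x \int[@lebesgue_measure R]_s (\1_A (x, s))%:E).
  apply: eq_integral => x _.
  rewrite -[LHS]lebesgue_measure_ray//.
  transitivity (\int[@lebesgue_measure R]_s (\1_(xsection A x) s)%:E).
    rewrite integral_indic// ?setIT; last exact: measurable_xsection.
    congr lebesgue_measure.
    by apply/seteqP; split => s; rewrite /xsection/= inE.
  by apply: eq_integral => s _; rewrite !indicE mem_xsection.
rewrite (fubini_tonelli (fun p : T * measurableTypeR R => (\1_A p)%:E))//.
- rewrite [RHS]integral_mkcond; apply: eq_integral => s _ /=.
  transitivity (\int[m]_x (\1_(ysection A s) x)%:E).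
    by apply: eq_integral => x _; rewrite !indicE mem_ysection.
  rewrite integral_indic// ?setIT; last exact: measurable_ysection.
  rewrite patchE; case: ifPn => [|];
    rewrite ?inE ?notin_setE/= in_itv/= andbT => s0.
  + congr (m _); apply/seteqP.
    split => x; rewrite /ysection/= inE/= /A/h/= patchE.
      case: ifPn; rewrite ?inE ?notin_setE; first by move=> ? [].
      by move=> _ [_]; rewrite ltNge lee_fin ltW.
    by move=> [Dx sx]; rewrite mem_set.
  + rewrite (_ : ysection _ _ = set0) ?measure0//.
    by apply/seteqP; split => x//; rewrite /ysection/= inE/= => -[].
- by apply/measurable_EFinP; exact: measurable_indic.
Qed.

(** * Decreasing rearrangement *)

Section rearrangement_theory.
Context {R : realType}.
Implicit Types (x : R -> R) (s t : R) (c : \bar R).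

Lemma rearrangement_le x s t : (0 <= s)%R ->
  distribution_fun x s <= t%:E -> rearrangement x t <= s%:E.
Proof. by move=> s0 xst; apply: ereal_inf_lbound; exists s. Qed.

Lemma rearrangement_ge x t c :
  (forall s, (0 <= s)%R -> s%:E < c -> t%:E < distribution_fun x s) ->
  c <= rearrangement x t.
Proof.
move=> h; apply: le_ereal_inf_tmp => _ [s [s0 xst] <-].
by rewrite leNgt; apply/negP => /(h _ s0); rewrite ltNge xst.
Qed.

Lemma rearrangement_ge0 x t : 0 <= rearrangement x t.
Proof. by apply: rearrangement_ge => s s0; rewrite ltNge lee_fin s0. Qed.

Lemma rearrangement_nonincreasing x s t : (s <= t)%R ->
  rearrangement x t <= rearrangement x s.
Proof.
move=> st; apply: ereal_inf_le_tmp => _ [r [r0 xr] <-].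
by exists r => //; split => //; rewrite (le_trans xr)// lee_fin.
Qed.

Lemma measurable_rearrangement x :
  measurable_fun (`]0%R, +oo[ : set (lebesgueR R))
    (rearrangement x : lebesgueR R -> \bar R).
Proof.
apply: nonincreasing_measurable_lebesgueR => s t _.
exact: rearrangement_nonincreasing.
Qed.

(** The rearrangement is equimeasurable with |x|; the inequality between the
    distribution functions that is used here follows from the definition of
    the rearrangement alone: if s < mu(t, x) then t < distribution_fun x s,
    so {s < mu(x)} is contained in an interval (0, distribution_fun x s). *)
Lemma integral_rearrangement_le x : Lebesgue_measurable_fun x ->
  \int[@lebesgue R]_(t in `]0%R, +oo[) rearrangement x t <=
  \int[@lebesgue R]_(t in `]0%R, +oo[) `|(x t)%:E|.
Proof.
move=> mx.
have mPos := measurable_itv_lebesgueR `]0%R, +oo[%R.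
rewrite layer_cake//; last 2 first.
- exact: measurable_rearrangement.
- by move=> t _; exact: rearrangement_ge0.
rewrite [leRHS]layer_cake//; last first.
  by apply: measurableT_comp => //; exact/measurable_EFinP.
have m_ni (f : R -> \bar R) : measurable_fun (`]0%R, +oo[ : set R)
   (fun s => @lebesgue R (`]0%R, +oo[ `&` [set t | s%:E < f t])).
  apply: nonincreasing_emeasurable => s t _ st; apply: le_lebesgue.
  by apply: setIS => r/=; apply: le_lt_trans; rewrite lee_fin.
apply: ge0_le_integral => //; [exact: m_ni|exact: m_ni|].
move=> s /=; rewrite in_itv/= andbT => s0.
have -> : @lebesgue R (`]0%R, +oo[ `&` [set t | s%:E < `|(x t)%:E|]) =
    distribution_fun x s.
  congr (lebesgue _); apply/seteqP.
  by split => t /=; rewrite in_itv/= andbT lte_fin.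
rewrite -[leRHS]lebesgue_measure_ray//.
apply: (@le_lebesgue _ _ [set t : R | (0 < t)%R /\ t%:E < _]) => t /=.
rewrite in_itv/= andbT => -[t0 sx]; split => //.
rewrite ltNge; apply/negP => /(rearrangement_le (ltW s0)).
by rewrite leNgt sx.
Qed.

End rearrangement_theory.

(** For 0 <= r < c the set {r < |y|} contains (0, tau), so its measure exceeds
    every s < tau; this means c <= mu(s, y) on (0, tau). *)
Lemma integral_rearrangement_ge (R : realType) (y : R -> R) (c tau t : R) :
  (0 <= c)%R -> (tau <= t)%R ->
  (forall s, (0 < s)%R -> (s < tau)%R -> (c <= `|y s|)%R) ->
  (c * tau)%:E <= \int[@lebesgue R]_(s in `]0%R, t]) rearrangement y s.
Proof.
move=> c0 taut cy.
have [tau0|tau0] := leP tau 0%R.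
  apply: (@le_trans _ _ 0); first by rewrite lee_fin mulr_ge0_le0.
  by apply: integral_ge0 => s _; exact: rearrangement_ge0.
have L_tau := lebesgue_itv0 tau0.
have mtau : measurable (`]0%R, tau[ : set (lebesgueR R)).
  exact: measurable_itv_lebesgueR.
have mt : measurable (`]0%R, t] : set (lebesgueR R)).
  exact: measurable_itv_lebesgueR.
have mry a b : measurable_fun
    ([set` Interval (BRight 0%R) (BSide a b)] : set (lebesgueR R))
    (rearrangement y : lebesgueR R -> \bar R).
  apply: measurable_funS (measurable_itv_lebesgueR `]0%R, +oo[) _
    (measurable_rearrangement y).
  by move=> s /=; rewrite !in_itv/= andbT => /andP[].
apply: (@le_trans _ _ (\int[@lebesgue R]_(s in `]0%R, tau[) rearrangement y s)).
  apply: (@le_trans _ _ (\int[@lebesgue R]_(s in `]0%R, tau[) (cst c%:E s))).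
    by rewrite integral_cst// EFinM -L_tau.
  apply: ge0_le_integral => //.
  move=> s /=; rewrite in_itv/= => /andP[s0 st].
  apply: rearrangement_ge => r r0 rc.
  apply: (@lt_le_trans _ _ tau%:E); first by rewrite lte_fin.
  rewrite -L_tau; apply: le_lebesgue => p /=; rewrite in_itv/= => /andP[p0 pt].
  by split => //; rewrite -lte_fin (lt_le_trans rc)// lee_fin cy.
apply: ge0_subset_integral => //.
- by move=> s _; exact: rearrangement_ge0.
- by move=> s /=; rewrite !in_itv/= => /andP[-> /ltW/le_trans->].
Qed.

(** * The Calderon operator on nonincreasing functions *)

Section calderon_theory.
Context {R : realType}.
Variable g : R -> \bar R.
Hypothesis g_ge0 : forall t, 0 <= g t.
Hypothesis g_ni : forall s t : R, (s <= t)%R -> g t <= g s.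

(** [kernel t] is nonincreasing, hence measurable, because both factors are
    nonincreasing and nonnegative. *)
Let kernel (t s : R) : \bar R := g s * (Num.min 1 (t / s))%:E.

Let kernel_ge0 t s : (0 < t)%R -> (0 < s)%R -> 0 <= kernel t s.
Proof.
by move=> t0 s0; rewrite mule_ge0// lee_fin le_min ler01/= divr_ge0// ltW.
Qed.

Let kernel_le t s : kernel t s <= g s.
Proof.
by rewrite -[leRHS]mule1 lee_wpmul2l// lee_fin ge_min lexx.
Qed.

Let measurable_kernel t : (0 < t)%R ->
  measurable_fun (`]0%R, +oo[ : set (lebesgueR R))
    (kernel t : lebesgueR R -> \bar R).
Proof.
move=> t0; apply: nonincreasing_measurable_lebesgueR => r s r0 rs.
have s0 : (0 < s)%R by rewrite (lt_le_trans r0).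
apply: lee_pmul => //; [|exact: g_ni|].
  by rewrite lee_fin le_min ler01/= divr_ge0// ltW.
rewrite lee_fin le_min ge_min lexx/= ge_min.
by rewrite ler_pM2l// lef_pV2 ?posrE// rs orbT.
Qed.

(** The two integrals defining [calderon] are the parts of one integral over
    s <= t and over t < s, where min(1, t / s) is 1 and t / s. *)
Lemma calderon_kernel t : (0 < t)%R ->
  t%:E * calderon g t = \int[@lebesgue R]_(s in `]0%R, +oo[) kernel t s.
Proof.
move=> t0.
have mA : measurable (`]0%R, t] : set (lebesgueR R)).
  exact: measurable_itv_lebesgueR.
have mB : measurable (`]t, +oo[ : set (lebesgueR R)).
  exact: measurable_itv_lebesgueR.
have PAB : (`]0%R, +oo[ = `]0%R, t] `|` `]t, +oo[ :> set (lebesgueR R))%classic.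
  by rewrite -itv_bndbnd_setU// bnd_simp ltW.
rewrite PAB ge0_integral_setU//; last 3 first.
- by rewrite -PAB; exact: measurable_kernel.
- by rewrite -PAB => s /=; rewrite in_itv/= andbT; exact: kernel_ge0.
- rewrite disj_set2E; apply/eqP/seteqP; split => s//=.
  by rewrite !in_itv/= andbT => -[/andP[_ st]]; rewrite ltNge st.
rewrite /calderon ge0_muleDr//; last 2 first.
- rewrite mule_ge0 ?lee_fin ?invr_ge0 ?(ltW t0)//.
  exact: integral_ge0.
- apply: integral_ge0 => s /=; rewrite in_itv/= andbT => ts.
  by rewrite mule_ge0// lee_fin invr_ge0 ltW// (lt_trans t0).
rewrite muleA -EFinM divff ?gt_eqF// mul1e; congr (_ + _).
- apply: eq_integral => s; rewrite inE/= in_itv/= => /andP[s0 st].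
  by rewrite /kernel min_l ?mule1// ler_pdivlMr// mul1r.
- rewrite -ge0_integralZl//=; last 3 first.
  + apply: (measurable_funS (measurable_itv_lebesgueR `]0%R, +oo[)).
      by move=> s /=; rewrite !in_itv/= !andbT; exact: lt_trans.
    apply: nonincreasing_measurable_lebesgueR => r s r0 rs.
    have s0 : (0 < s)%R by rewrite (lt_le_trans r0).
    apply: lee_pmul => //; [|exact: g_ni|].
      by rewrite lee_fin invr_ge0 ltW.
    by rewrite lee_fin lef_pV2.
  + move=> s; rewrite in_itv/= andbT => ts.
    by rewrite mule_ge0// lee_fin invr_ge0 ltW// (lt_trans t0).
  + by rewrite lee_fin ltW.
  apply: eq_integral => s; rewrite inE/= in_itv/= andbT => ts.
  have s0 := lt_trans t0 ts.
  by rewrite /kernel min_r ?EFinM 1?muleCA// ler_pdivrMr// mul1r ltW.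
Qed.

Lemma calderon_le_integral t : (0 < t)%R ->
  t%:E * calderon g t <= \int[@lebesgue R]_(s in `]0%R, +oo[) g s.
Proof.
move=> t0; rewrite calderon_kernel//; apply: ge0_le_integral => //.
- exact: measurable_itv_lebesgueR.
- by move=> s /=; rewrite in_itv/= andbT; exact: kernel_ge0.
- exact: measurable_kernel.
- by apply: nonincreasing_measurable_lebesgueR => r s _; exact: g_ni.
Qed.

(** Dominated convergence along every sequence u_n -> 0+, with dominating
    function g: min(1, u_n / s) tends to 0 for each s, and g is finite almost
    everywhere. *)
Lemma calderon_cvg0 : \int[@lebesgue R]_(s in `]0%R, +oo[) g s < +oo ->
  t%:E * calderon g t @[t --> 0%R^'+] --> 0.
Proof.
move=> g_oo; apply/cvge_at_rightP => u [u0 ucvg].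
have mg : measurable_fun (`]0%R, +oo[ : set (lebesgueR R))
    (g : lebesgueR R -> \bar R).
  by apply: nonincreasing_measurable_lebesgueR => r s _; exact: g_ni.
have ig : (@lebesgue R).-integrable `]0%R, +oo[ g.
  apply/integrableP; split => //.
  by under eq_integral do rewrite gee0_abs//.
have [//| | | | | _ _] := @dominated_convergence _ _ _ (@lebesgue R)
  `]0%R, +oo[%classic (measurable_itv_lebesgueR `]0%R, +oo[)
  (fun n => kernel (u n)) (cst 0) g.
- by move=> n; exact: measurable_kernel.
- exact: measurable_cst.
- apply: filterS (integrable_ae (measurable_itv_lebesgueR `]0%R, +oo[) ig).
  move=> s gfin /=.
  rewrite in_itv/= andbT => s0.
  rewrite -(mule0 (g s)); apply: cvgeZl.
    by apply: gfin; rewrite /= in_itv/= s0.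
  apply: (@squeeze_cvge _ _ _ _ (cst 0) _ (fun n => (u n / s)%:E)).
  + apply: nearW => n; rewrite !lee_fin ge_min lexx orbT andbT.
    by rewrite le_min ler01 divr_ge0// ltW.
  + exact: cvg_cst.
  + by apply: cvg_EFin; [exact: nearW|]; rewrite -(mul0r s^-1)%R; exact: cvgMl.
- exact: ig.
- apply: nearW => s n; rewrite /= in_itv/= andbT => s0.
  by rewrite gee0_abs ?kernel_ge0.
rewrite integral0; apply: cvg_trans.
by apply: near_eq_cvg; apply: nearW => n; rewrite calderon_kernel.
Qed.

End calderon_theory.

(** * A series of indicators with prescribed masses *)

Section indicator_series.
Context {R : realType}.
Variables (C : R) (tau : nat -> R).
Hypothesis C0 : (0 <= C)%R.
Hypothesis tau0 : forall k, (0 < tau k)%R.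
Hypothesis tau_cvg0 : tau k @[k --> \oo] --> (0 : R)%R.

Let c k : R := (C / 2 ^+ k.+1 / tau k)%R.

Let c_ge0 k : (0 <= c k)%R.
Proof. by rewrite !divr_ge0// ltW. Qed.

Let f k (t : R) : \bar R := (c k * \1_(`]0%R, tau k[) t)%:E.

Let f_ge0 k t : 0 <= f k t.
Proof. by rewrite lee_fin mulr_ge0. Qed.

(** The k-th term has integral C / 2^(k+1) and lives on (0, tau k).  The sum is
    finite everywhere because each t > 0 lies in only finitely many of the
    intervals (0, tau k), so [fine] discards nothing. *)
Definition indicator_series (t : R) : R := fine (\sum_(k <oo) f k t).

Let series_fin t : \sum_(k <oo) f k t \is a fin_num.
Proof.
have [t0|t0] := leP t 0%R.
  rewrite eseries0// => k _ _; rewrite /f indicE memNset ?mulr0//=.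
  by rewrite in_itv/= ltNge t0.
have /cvgrPdist_lt/(_ _ t0)[N _ Nt] := tau_cvg0.
rewrite (nneseries_split 0 N)//.
rewrite eseries0 ?adde0; last first.
  move=> k Nk _; rewrite /f indicE memNset ?mulr0//=.
  rewrite in_itv/= => /andP[_]; rewrite ltNge => /negP; apply.
  by have := Nt _ Nk; rewrite sub0r normrN gtr0_norm// => /ltW.
by rewrite sumEFin.
Qed.

Lemma indicator_series_ge k t : (0 < t)%R -> (t < tau k)%R ->
  (C / 2 ^+ k.+1 / tau k <= indicator_series t)%R.
Proof.
move=> t0 ttau; rewrite -lee_fin fineK//.
have -> : (C / 2 ^+ k.+1 / tau k)%:E = f k t.
  by rewrite /f indicE mem_set ?mulr1//= in_itv/= t0.
rewrite (nneseries_split 0 k.+1)// add0n big_nat_recr//= -addeA addeCA leeDl//.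
by apply: adde_ge0; [exact: sume_ge0|exact: nneseries_ge0].
Qed.

Lemma indicator_series_L1 : L1 indicator_series.
Proof.
have mf k : measurable_fun (`]0%R, +oo[ : set (lebesgueR R))
    (f k : lebesgueR R -> \bar R).
  apply/measurable_EFinP; apply: measurable_funM => //.
  apply: measurable_indic; exact: measurable_itv_lebesgueR.
have -> : L1 indicator_series =
    (@lebesgue R).-integrable `]0%R, +oo[ (fun t => \sum_(k <oo) f k t).
  rewrite /L1/=; congr ((_.-integrable _ _) : Prop).
  by apply/funext => t; rewrite /indicator_series fineK.
apply/integrableP; split; first exact: ge0_emeasurable_sum.
under eq_integral do rewrite gee0_abs ?nneseries_ge0//.
rewrite integral_nneseries//; last exact: measurable_itv_lebesgueR.
rewrite (eq_eseriesr (g := fun k => (C / (2 ^ k.+1)%:R)%:E)); last first.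
  move=> k _; rewrite /f.
  under eq_integral do rewrite EFinM.
  rewrite ge0_integralZl_EFin//=; last 2 first.
  - exact: measurable_itv_lebesgueR.
  - apply/measurable_EFinP; apply: measurable_indic.
    exact: measurable_itv_lebesgueR.
  rewrite integral_indic//; [|exact: measurable_itv_lebesgueR..].
  rewrite (_ : _ `&` _ = `]0%R, tau k[%classic); last first.
    by apply/setIidl => t /=; rewrite !in_itv/= andbT => /andP[].
  rewrite [X in _ * X](_ : _ = (tau k)%:E); last exact: lebesgue_itv0.
  by rewrite -EFinM divfK ?gt_eqF// natrX.
exact: le_lt_trans (epsilon_trick0 xpredT C0) (ltry _).
Qed.

End indicator_series.

(** * The two inclusions *)

Lemma calderon_range_L1_sub (R : realType) :
  calderon_range (@L1 R) `<=` @weakL1_0 R.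
Proof.
move=> _ [[u uw [v vi <-]] [y [yL1 le_xy]]].
set x := (fun t => u t + v t)%R in le_xy *.
have my : Lebesgue_measurable_fun y.
  exact/measurable_EFinP/(measurable_int _ yL1).
have mx : Lebesgue_measurable_fun x.
  by apply: measurable_funD; [exact: uw.1.1|exact: vi.1].
have y_fin : \int[@lebesgue R]_(t in `]0%R, +oo[) rearrangement y t < +oo.
  apply: le_lt_trans (integral_rearrangement_le my) _.
  by have /integrableP[] := yL1.
have x_le t : (0 < t)%R ->
    t%:E * rearrangement x t <= t%:E * calderon (rearrangement y) t.
  by move=> t0; rewrite lee_wpmul2l ?lee_fin ?(ltW t0)// le_xy.
have y0 := rearrangement_ge0 y.
have y_ni := @rearrangement_nonincreasing _ y.
have x_bound t : (0 < t)%R -> t%:E * rearrangement x t <=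
    \int[@lebesgue R]_(t in `]0%R, +oo[) rearrangement y t.
  by move=> t0; rewrite (le_trans (x_le _ t0))// calderon_le_integral.
split; first split; first split => //.
- (* Finiteness of mu(1, x) gives some s >= 0 with a distribution of at most 1;
     the shift to s + 1 makes the level positive. *)
  have /ereal_inf_lt[_ [s [s0 xs] <-] _] : rearrangement x 1%R < +oo.
    by rewrite (le_lt_trans _ y_fin)// -[leLHS]mul1e x_bound.
  exists (s + 1)%R; split; first by rewrite ltr_wpDl.
  apply: le_lt_trans (le_lt_trans xs (ltry _)).
  apply: le_lebesgue => t /= [t0 st]; split => //.
  by rewrite (lt_trans _ st)// ltrDl.
- rewrite (le_lt_trans _ y_fin)//; apply: ge_ereal_sup => _ [t + <-].
  by rewrite /= in_itv/= andbT; exact: x_bound.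
- apply: (@squeeze_cvge _ _ _ _ (cst 0) _
    (fun t => t%:E * calderon (rearrangement y) t)).
  + near=> t; rewrite x_le//= andbT mule_ge0// ?rearrangement_ge0//.
    by rewrite lee_fin ltW.
  + exact: cvg_cst.
  + exact: calderon_cvg0.
Unshelve. all: by end_near. Qed.

Lemma weakL1_0_sub (R : realType) :
  @weakL1_0 R `<=` calderon_range (@L1 R).
Proof.
move=> x [xw x_cvg].
split.
  exists x => //; exists (cst 0%R); last by apply/funext => t; rewrite addr0.
  split; first exact: measurable_cst.
  by exists 0%R; apply: nearW => t _ /=; rewrite normr0.
have [_ x_sup] := xw.
pose S := ereal_sup [set t%:E * rearrangement x t | t in `]0%R, +oo[%classic].
have x_le t : (0 < t)%R -> t%:E * rearrangement x t <= S.
  by move=> t0; apply: ereal_sup_ubound; exists t => //=; rewrite in_itv/= t0.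
have S0 : 0 <= S.
  by apply: le_trans (x_le _ ltr01); rewrite mul1e rearrangement_ge0.
have Sfin : S \is a fin_num by rewrite ge0_fin_numE.
(* C / 2, the integral of the term of index 0, has to be at least S, the only
   bound for t mu(t, x) when t >= tau 0; the added 1 makes C positive. *)
pose C := ((fine S + 1) * 2)%R.
have C0 : (0 < C)%R by rewrite mulr_gt0// ltr_wpDl// fine_ge0.
have /choice[tau tauP] (k : nat) : exists tau : R,
    [/\ (0 < tau)%R, (tau <= k.+1%:R^-1)%R &
    forall t, (0 < t)%R -> (t < tau)%R ->
      t%:E * rearrangement x t <= (C / 2 ^+ k.+2)%:E].
  have e0 : (0 < C / 2 ^+ k.+2)%R by rewrite divr_gt0.
  have : \forall t \near 0%R^'+, t%:E * rearrangement x t <= (C / 2 ^+ k.+2)%:E.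
    apply: (x_cvg [set z | z <= (C / 2 ^+ k.+2)%:E]).
    by apply: filterS (nbhs_open_ereal_lt (f := cst _) e0) => z /ltW.
  move=> [d /= d0 dx].
  (* The minimum with 1 / (k + 1) forces tau to tend to 0. *)
  exists (Num.min d k.+1%:R^-1)%R; split.
  - by rewrite lt_min d0/= invr_gt0.
  - by rewrite ge_min lexx orbT.
  - move=> t t0; rewrite lt_min => /andP[td _]; apply: dx => //=.
    by rewrite sub0r normrN gtr0_norm.
have tau0 k : (0 < tau k)%R by have [] := tauP k.
have tau_cvg0 : tau k @[k --> \oo] --> (0 : R)%R.
  apply: (@squeeze_cvgr _ _ _ _ (cst 0%R) harmonic).
  - by apply: nearW => k; rewrite (ltW (tau0 k))/=; have [] := tauP k.
  - exact: cvg_cst.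
  - exact: cvg_harmonic.
exists (indicator_series C tau); split.
  exact: indicator_series_L1 (ltW C0) tau0 tau_cvg0.
move=> t t0.
set y := indicator_series C tau.
have y_ge k : (tau k <= t)%R ->
    (C / 2 ^+ k.+1)%:E <= \int[@lebesgue R]_(s in `]0%R, t]) rearrangement y s.
  move=> taut.
  have -> : (C / 2 ^+ k.+1 = C / 2 ^+ k.+1 / tau k * tau k)%R.
    by rewrite divfK// gt_eqF.
  apply: integral_rearrangement_ge => //.
    by rewrite !divr_ge0// ltW.
  move=> s s0 st; apply: le_trans (ler_norm _).
  exact: indicator_series_ge (ltW C0) tau0 tau_cvg0 _ _ s0 st.
have {}y_ge : t%:E * rearrangement x t <=
    \int[@lebesgue R]_(s in `]0%R, t]) rearrangement y s.
  have ex_k : exists k, (tau k <= t)%R.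
    have /cvgrPdist_lt/(_ _ t0)[N _ /(_ N (leqnn N))] := tau_cvg0.
    by rewrite sub0r normrN gtr0_norm// => /ltW; exists N.
  case: (ex_minnP ex_k) => -[|k] tk kmin; apply: le_trans (y_ge _ tk).
    apply: le_trans (x_le _ t0) _; rewrite -(fineK Sfin) lee_fin expr1 /C.
    by rewrite mulfK// lerDl.
  have [_ _ ->//] := tauP k.
  by rewrite ltNge; apply/negP => /kmin; rewrite ltnn.
apply: (@le_trans _ _
    (t^-1%:E * \int[@lebesgue R]_(s in `]0%R, t]) rearrangement y s)).
  by rewrite lee_pdivlMl.
rewrite leeDl//; apply: integral_ge0 => s /=; rewrite in_itv/= andbT => ts.
by rewrite mule_ge0 ?rearrangement_ge0// lee_fin invr_ge0 ltW// (lt_trans t0).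
Qed.

Theorem proposition35 (R : realType) :
  calderon_range (@L1 R) = @weakL1_0 R.
Proof.
by apply/seteqP; split; [exact: calderon_range_L1_sub|exact: weakL1_0_sub].
Qed.
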